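(* For commutative cancellative monoids, the following statements hold. (1) Every strongly atomic monoid is atomic. (2) Every weak-ACCP monoid is strongly atomic. (3) None of the implications in the chain ACCP $\Rightarrow$ weak-ACCP $\Rightarrow$ strongly atomic $\Rightarrow$ atomic is reversible; that is, there exist a weak-ACCP monoid that does not satisfy ACCP, a strongly atomic monoid that is not weak-ACCP, and an atomic monoid that is not strongly atomic.
   Context: Monoids are commutative and cancellative, written additively with identity $0$. Let $M$ be such a monoid and let $\mathcal{U}(M)$ be its group of invertible elements (units). For $b,c\in M$, $b$ divides $c$ in $M$ if $c=b+b'$ for some $b'\in M$, and then $c-b$ denotes this (unique) $b'$. A common divisor of a subset of $M$ is an element of $M$ dividing each element of the subset. An atom of $M$ is an element $a\in M\setminus\mathcal{U}(M)$ such that $a=u+v$ with $u,v\in M$ implies $u\in\mathcal{U}(M)$ or $v\in\mathcal{U}(M)$; $\mathcal{A}(M)$ is the set of atoms and $\langle\mathcal{A}(M)\rangle$ the submonoid it generates. $M$ is atomic if every non-invertible element is a sum of atoms. $M$ satisfies ACCP if every ascending chain of principal ideals (sets of the form $c+M$) eventually stabilizes; an element $b\in M$ satisfies ACCP if every ascending chain of principal ideals starting at $b+M$ eventually stabilizes. $M$ is weak-ACCP if $M$ is atomic and every nonempty finite subset $S$ of $M$ has a common divisor $d\in M$ such that $s-d$ satisfies ACCP for some $s\in S$. $M$ is strongly atomic if for all $b,c\in M$ there is a common divisor $d\in\langle\mathcal{A}(M)\rangle$ of $b$ and $c$ in $M$ such that the only common divisors of $b-d$ and $c-d$ in $M$ are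 units. *)

(* Defs.v *)
From HB Require Import structures.
From mathcomp Require Import all_boot all_order all_algebra.
From mathcomp Require Import mathcomp_extra boolp classical_sets functions.
From mathcomp Require Import cardinality.

Set Implicit Arguments.
Unset Strict Implicit.
Unset Printing Implicit Defensive.

Import GRing.Theory.
Local Open Scope classical_set_scope.
Local Open Scope ring_scope.

(* Commutative monoids are [nmodType]s; cancellativity is a separate
   hypothesis. *)
Definition cancellative (M : nmodType) : Prop :=
  forall x y z : M, x + y = x + z -> y = z.

Section Elements.
Variable M : nmodType.
Implicit Types (a b c d u v : M) (S : set M) (I : nat -> set M).

Definition invertible u : Prop := exists v, u + v = 0.

(* [is_difference c b b'] reads "b divides c and c - b = b'"; when [M] is
   cancellative there is at most one such b'. *)
Definition is_difference c b b' : Prop := c = b + b'.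

Definition divides b c : Prop := exists b', is_difference c b b'.

Definition common_divisor S d : Prop := forall s, S s -> divides d s.

Definition atom a : Prop :=
  ~ invertible a /\ forall u v, a = u + v -> invertible u \/ invertible v.

Definition atoms : set M := [set a | atom a].

Definition submonoid S : Prop :=
  S 0 /\ forall x y, S x -> S y -> S (x + y).

Definition generated_submonoid S : set M := smallest submonoid S.

Definition principal_ideal c : set M := [set c + x | x in [set: M]].

Definition ascending_principal_chain I : Prop :=
  (forall n, exists c, I n = principal_ideal c) /\
  (forall n, I n `<=` I n.+1).

Definition stabilizes I : Prop :=
  exists N, forall n, (N <= n)%N -> I n = I N.

Definition element_ACCP b : Prop :=
  forall I, ascending_principal_chain I -> I 0%N = principal_ideal b ->
    stabilizes I.

End Elements.

Section Monoids.
Variable M : nmodType.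

Definition atomic : Prop :=
  forall b : M, ~ invertible b ->
    exists s : seq M, (forall a, a \in s -> atom a) /\ b = \sum_(a <- s) a.

Definition ACCP : Prop :=
  forall I : nat -> set M, ascending_principal_chain I -> stabilizes I.

Definition weak_ACCP : Prop :=
  atomic /\
  forall S : set M, finite_set S -> S !=set0 ->
    exists d, common_divisor S d /\
      exists s s', [/\ S s, is_difference s d s' & element_ACCP s'].

Definition strongly_atomic : Prop :=
  forall b c : M, exists d,
    [/\ generated_submonoid (@atoms M) d,
        common_divisor [set b; c] d &
        exists b' c', [/\ is_difference b d b', is_difference c d c' &
          forall e, common_divisor [set b'; c'] e -> invertible e]].

End Monoids.

(* Main.v *)
Require Import Defs.
From HB Require Import structures.
From mathcomp Require Import all_boot all_order all_algebra.
From mathcomp Require Import finmap boolp classical_sets.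
From mathcomp Require Import cardinality lra.

(** Parts (1) and (2).  Applied to the pair (b, b), strong atomicity writes b
    as d + u with d a sum of atoms and u a common divisor of u and u, hence a
    unit; absorbing u in one of the atoms proves (1).  For (2), an element
    satisfying ACCP has, with any other element, an atomic common divisor
    whose cofactors are coprime ([ACCP_atomic_mcd]): keep removing nonunit
    common divisors, which are sums of atoms; the removal stops because
    the ideals generated by the first cofactor strictly increase.  A weak-ACCP
    monoid reduces every pair to such a pair by removing one common divisor.

    Part (3).  Let D be a reduced cancellative monoid, and adjoin to D, for
    each nonzero r, a new generator [half r] with half r + half r = r.  Each
    element of the resulting monoid [halving D] is uniquely d plus the halves of
    a finite set A of nonzero elements, because equal halves merge in pairs.
    The halves are atoms and every nonzero element of D is a sum of two of them,
    so [halving D] is atomic, although divisibility between elements of D is the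
    same in [halving D] as in D ([divides_base]).
    - For D the nonnegative rationals, the halving is weak-ACCP: one can remove
      the least D-component occurring in a finite set, and an element whose
      D-component is 0 has only finitely many divisors, given by the subsets of
      A.  It does not satisfy ACCP, because 1, 1/2, 1/3, ... is a chain.
    - Strong atomicity passes to products, but weak-ACCP does not: if x fails
      ACCP, then (x, 0) and (0, x) have only unit common divisors and both fail
      ACCP.  So the square of the previous monoid is strongly atomic, by (2),
      and not weak-ACCP.
    - For D made of 0 and the pairs (q, z) with q a positive rational and z an
      integer, common divisors of (1, 0) and (1, 1) have 0 <= q < 1, and one can
      always remove a little more.  This persists in the halving, which is
      therefore not strongly atomic. *)

Set Implicit Arguments.
Unset Strict Implicit.
Unset Printing Implicit Defensive.

Import Order.TTheory GRing.Theory Num.Theory.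
Local Open Scope ring_scope.

(** * Divisibility, chains and sums of atoms *)

Section Divisibility.
Local Open Scope classical_set_scope.
Variable M : nmodType.
Implicit Types b c d e u v x y z : M.

Lemma common_divisor2 b c d :
  common_divisor [set b; c] d <-> divides d b /\ divides d c.
Proof.
split=> [dP | [db dc] s [->|->] //].
by split; apply: dP; [left | right].
Qed.

Lemma principal_idealP c y : principal_ideal c y <-> divides c y.
Proof.
split=> [[x _ <-] | [x ->]]; first by exists x.
by exists x.
Qed.

Lemma divides_refl b : divides b b.
Proof. by exists 0; rewrite /is_difference addr0. Qed.

Lemma divides_trans b c d : divides b c -> divides c d -> divides b d.
Proof.
by move=> [x ->] [y ->]; exists (x + y); rewrite /is_difference addrA.
Qed.

Lemma principal_ideal_subset b c :
  principal_ideal b `<=` principal_ideal c <-> divides c b.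
Proof.
split=> [bc | cb x /principal_idealP bx].
  by apply/principal_idealP/bc/principal_idealP; exact: divides_refl.
by apply/principal_idealP; apply: divides_trans bx.
Qed.

Lemma principal_chain (x : nat -> M) : (forall n, divides (x n.+1) (x n)) ->
  ascending_principal_chain (fun n => principal_ideal (x n)).
Proof.
by move=> xS; split=> n; [exists (x n) | apply/principal_ideal_subset].
Qed.

Lemma chain_subset (I : nat -> set M) m n :
  ascending_principal_chain I -> (m <= n)%N -> I m `<=` I n.
Proof.
move=> [_ IS]; elim: n => [|n IHn]; first by rewrite leqn0 => /eqP->.
by rewrite leq_eqVlt => /predU1P[->//|/IHn mn]; apply: subset_trans (IS n).
Qed.

Lemma chain_generators (I : nat -> set M) : ascending_principal_chain I ->
  exists x : nat -> M, (forall n, I n = principal_ideal (x n)) /\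
    forall n, divides (x n.+1) (x n).
Proof.
move=> [/choice[x Ix] IS]; exists x; split=> // n.
by apply/principal_ideal_subset; rewrite -!Ix.
Qed.

Lemma invertible0 : invertible (0 : M).
Proof. by exists 0; rewrite addr0. Qed.

Lemma invertibleDl u v : invertible (u + v) -> invertible u.
Proof. by move=> [w uvw]; exists (v + w); rewrite addrA. Qed.

Lemma atomD_invertible a u : atom a -> invertible u -> atom (a + u).
Proof.
move=> [aN aP] [v uv]; split=> [/invertibleDl //|x y axy].
have : a = x + (y + v) by rewrite addrA -axy -addrA uv addr0.
by move=> /aP[|/invertibleDl]; [left | right].
Qed.

Lemma generated_submonoidP : submonoid (generated_submonoid (@atoms M)).
Proof.
split=> [X [[X0 _] _] // | x y Gx Gy X XP].
by have [[_ XD] _] := XP; apply: XD; [exact: Gx | exact: Gy].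
Qed.

Lemma atom_generated a : atom a -> generated_submonoid (@atoms M) a.
Proof. by move=> aA X [_]; apply. Qed.

Lemma sum_atoms_generated (I : eqType) (s : seq I) (F : I -> M) :
  (forall i, i \in s -> atom (F i)) ->
  generated_submonoid (@atoms M) (\sum_(i <- s) F i).
Proof.
have [G0 GD] := generated_submonoidP.
move=> sA; rewrite big_seq; elim/big_ind: _ => // i /sA.
exact: atom_generated.
Qed.

Lemma generated_sum_atoms d : generated_submonoid (@atoms M) d ->
  exists s : seq M, (forall a, a \in s -> atom a) /\ d = \sum_(a <- s) a.
Proof.
move=> dG; apply: (dG [set d | exists s : seq M,
  (forall a, a \in s -> atom a) /\ d = \sum_(a <- s) a]); split.
- split=> [|x y [s [sA ->]] [t [tA ->]]]; first by exists [::]; rewrite big_nil.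
  exists (s ++ t); rewrite big_cat; split=> // a.
  by rewrite mem_cat => /orP[/sA|/tA].
- by move=> a aA; exists [:: a]; rewrite big_seq1; split=> // ? /[1!inE] /eqP->.
Qed.

End Divisibility.

(** * Common divisors with coprime cofactors *)

Section Implications.
Local Open Scope classical_set_scope.
Variable M : nmodType.
Implicit Types b c d e u v x y z : M.

Definition coprime_elements b c :=
  forall e, common_divisor [set b; c] e -> invertible e.

(** The condition that strong atomicity imposes on the pair (b, c). *)
Definition atomic_mcd b c := exists d b' c',
  [/\ generated_submonoid (@atoms M) d, b = d + b', c = d + c' &
      coprime_elements b' c'].

Lemma strongly_atomicP :
  strongly_atomic M <-> forall b c, atomic_mcd b c.
Proof.
split=> H b c.
  by have [d [dA _ [b' [c' [? ? ?]]]]] := H b c; exists d, b', c'.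
have [d [b' [c' [dA bE cE bc]]]] := H b c; exists d; split=> //.
  by apply/common_divisor2; split; [exists b' | exists c'].
by exists b', c'.
Qed.

Lemma strongly_atomic_atomic : cancellative M -> strongly_atomic M -> atomic M.
Proof.
move=> MC /strongly_atomicP MS b bN.
have [d [u [u' [/generated_sum_atoms[s [sA dE]] bE bE' uu]]]] := MS b b.
have uE : u' = u by apply: (MC d); rewrite -bE.
have {uu} uI : invertible u.
  by apply: uu; rewrite uE; apply/common_divisor2; split; exact: divides_refl.
case: s => [|a s] in sA dE *.
  by move: bN; rewrite bE dE big_nil add0r.
exists (a + u :: s); split=> [x|]; last first.
  by rewrite bE dE !big_cons addrAC.
rewrite inE => /predU1P[->|xs]; last by apply: sA; rewrite inE xs orbT.
by apply: atomD_invertible => //; apply: sA; rewrite mem_head.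
Qed.

Lemma atomic_mcdC b c : atomic_mcd b c -> atomic_mcd c b.
Proof.
move=> [d [b' [c' [dA bE cE bc]]]]; exists d, c', b'; split=> // e.
by rewrite setUC; apply: bc.
Qed.

(** A nonunit common divisor is a sum of atoms that joins the atomic part,
    while a unit is absorbed in the cofactors. *)
Lemma atomic_mcd_shift e b c : atomic M -> atomic_mcd b c ->
  atomic_mcd (e + b) (e + c).
Proof.
move=> MA [d [b' [c' [dA -> -> bc]]]].
have [eI|/MA[s [sA eE]]] := pselect (invertible e); last first.
  exists (e + d), b', c'; rewrite !addrA; split=> //.
  have [_ GD] := generated_submonoidP M.
  by apply: GD => //; rewrite eE; exact: sum_atoms_generated.
exists d, (e + b'), (e + c'); split=> //; do 1?exact: addrCA.
have [e' ee'] := eI => f /common_divisor2[[x xE] [y yE]].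
apply: bc; apply/common_divisor2; split; [exists (e' + x) | exists (e' + y)].
  by rewrite /is_difference addrCA -xE addrA [e' + e]addrC ee' add0r.
by rewrite /is_difference addrCA -yE addrA [e' + e]addrC ee' add0r.
Qed.

Lemma ACCP_atomic_mcd b c : cancellative M -> atomic M ->
  element_ACCP b -> atomic_mcd b c.
Proof.
move=> MC MA bACCP; apply: contrapT => bcN.
pose bad := {p : M * M | ~ atomic_mcd p.1 p.2}.
pose next (p q : bad) := exists2 z, ~ invertible z &
  (sval p).1 = z + (sval q).1.
(* A pair without atomic mcd is not coprime, as 0 would be an atomic mcd. *)
have nextP (p : bad) : {q : bad | next p q}.
  apply: cid; case: p => [[x y] /= xyN].
  have : ~ coprime_elements x y.
    move=> xy; apply: xyN; exists 0, x, y; rewrite !add0r; split=> //.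
    by have [] := generated_submonoidP M.
  move=> /existsNP[z /not_implyP[/common_divisor2[[x' xE] [y' yE]] zN]].
  have x'y'N : ~ atomic_mcd x' y'.
    by move=> /(atomic_mcd_shift z MA); rewrite -xE -yE.
  by exists (exist _ (x', y') x'y'N), z.
have [p [p0 pS]] := dependent_choice nextP (exist _ (b, c) bcN).
pose x n := (sval (p n)).1.
have xS n : exists2 z, ~ invertible z & x n = z + x n.+1 := pS n.
have xdiv n : divides (x n.+1) (x n).
  by have [z _ ->] := xS n; exists z; exact: addrC.
have [|N NP] := bACCP _ (principal_chain xdiv); first by rewrite /x p0.
have [z zN xN] := xS N.
have /principal_ideal_subset[w xN1] :
  principal_ideal (x N.+1) `<=` principal_ideal (x N) by rewrite NP.
apply: zN; exists w; apply: (MC (x N.+1)).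
by rewrite addr0 addrA [_ + z]addrC -xN -xN1.
Qed.

Lemma weak_ACCP_strongly_atomic :
  cancellative M -> weak_ACCP M -> strongly_atomic M.
Proof.
move=> MC [MA MW]; apply/strongly_atomicP => b c.
have [||d [/common_divisor2[[b' bE] [c' cE]] [s [s' [sS sE s'A]]]]] :=
  MW [set b; c]; [exact: finite_set2 | by exists b; left |].
rewrite bE cE; apply: atomic_mcd_shift => //.
case: sS => s_eq.
  have <- : s' = b' by apply: (MC d); rewrite -bE -s_eq.
  exact: ACCP_atomic_mcd.
have <- : s' = c' by apply: (MC d); rewrite -cE -s_eq.
by apply/atomic_mcdC/ACCP_atomic_mcd.
Qed.

(** Along a chain the ranks of the generators eventually stop decreasing, and
    from then on consecutive generators differ by units. *)
Lemma rank_element_ACCP (b : M) (rank : M -> nat) :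
  (forall x z, divides (x + z) b ->
     (rank x <= rank (x + z)%R)%N /\
     (rank x = rank (x + z) -> invertible z)) ->
  element_ACCP b.
Proof.
move=> rankP I IP I0.
have [x [xE xS]] := chain_generators IP.
have xb n : divides (x n) b.
  apply/principal_ideal_subset; rewrite -I0 -xE.
  exact: chain_subset.
have rank_div m n : divides (x n) (x m) -> (rank (x n) <= rank (x m))%N.
  by move=> [z mE]; rewrite mE; apply: (rankP _ _ _).1; rewrite -mE.
have xmn m n : (m <= n)%N -> divides (x n) (x m).
  by move=> mn; apply/principal_ideal_subset; rewrite -!xE; exact: chain_subset.
have [N Nmin] : exists N, forall n, (rank (x N) <= rank (x n))%N.
  have ex : exists k, `[< exists n, rank (x n) = k >].
    by exists (rank (x 0%N)); apply/asboolP; exists 0%N.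
  have [k /asboolP[N NE] kmin] := ex_minnP ex.
  by exists N => n; rewrite NE; apply: kmin; apply/asboolP; exists n.
exists N => n Nn; apply/seteqP; split; last exact: chain_subset.
have [z NE] := xmn _ _ Nn.
have [w zw] : invertible z.
  apply: (rankP (x n) z _).2; first by rewrite -NE.
  by apply/eqP; rewrite -NE eqn_leq Nmin andbT; apply/rank_div/xmn.
rewrite !xE; apply/principal_ideal_subset; exists w.
by rewrite /is_difference NE -addrA zw addr0.
Qed.

End Implications.

(** Ascending chains are carried forward by maps that preserve and reflect
    divisibility. *)
Lemma embedding_element_ACCP (M N : nmodType) (f : M -> N) (x : M) (p : N) :
  (forall y z, divides (f y) (f z) <-> divides y z) ->
  divides p (f x) -> divides (f x) p -> element_ACCP p -> element_ACCP x.
Proof.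
move=> fdiv pf fp pA I IP I0.
have [y [yE yS]] := chain_generators IP.
have [||K KP] := pA (fun n => principal_ideal (f (y n))).
- by apply: principal_chain => n; apply/fdiv.
- have [xy yx] : divides x (y 0%N) /\ divides (y 0%N) x.
    by split; apply/principal_ideal_subset; rewrite -yE I0.
  apply/seteqP; split; apply/principal_ideal_subset.
    by apply: divides_trans pf _; apply/fdiv.
  by apply: divides_trans fp; apply/fdiv.
exists K => n Kn; rewrite !yE.
apply/seteqP; split; apply/principal_ideal_subset/fdiv/principal_ideal_subset;
  by rewrite KP.
Qed.

Lemma embedding_ACCP (M N : nmodType) (f : M -> N) :
  (forall y z, divides (f y) (f z) <-> divides y z) -> ACCP N -> ACCP M.
Proof.
move=> fdiv NA I IP; have [x I0] := IP.1 0%N.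
apply: (@embedding_element_ACCP _ _ f x (f x)) I0 => //.
- exact: divides_refl.
- exact: divides_refl.
- by move=> J JP _; apply: NA.
Qed.

(** * The square of a monoid *)

Section Square.
Local Open Scope classical_set_scope.
Variable M : nmodType.
Hypothesis MC : cancellative M.

Lemma square_cancellative : cancellative (M * M)%type.
Proof. by move=> [a b] [c d] [e f] [] /MC-> /MC->. Qed.

Lemma square_invertible (u : M * M) :
  invertible u <-> invertible u.1 /\ invertible u.2.
Proof.
split=> [[v] | [[x ux] [y uy]]].
  by case: u v => [? ?] [x y] [ux uy]; split; [exists x | exists y].
by exists (x, y); case: u ux uy => ? ? /= ux uy; congr pair.
Qed.

Lemma atom_pairl (a : M) : atom a -> atom ((a, 0) : M * M).
Proof.
move=> [aN aP]; split=> [/square_invertible[] //|[u u'] [v v'] [/aP uv uv']].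
have u'I : invertible u' by exists v'.
have v'I : invertible v' by exists u'; rewrite addrC.
by case: uv => ?; [left | right]; apply/square_invertible.
Qed.

Lemma atom_pairr (a : M) : atom a -> atom ((0, a) : M * M).
Proof.
move=> [aN aP]; split=> [/square_invertible[] //|[u' u] [v' v] [uv' /aP uv]].
have u'I : invertible u' by exists v'.
have v'I : invertible v' by exists u'; rewrite addrC.
by case: uv => ?; [left | right]; apply/square_invertible.
Qed.

Lemma generated_pair (d e : M) :
  generated_submonoid (@atoms M) d -> generated_submonoid (@atoms M) e ->
  generated_submonoid (@atoms (M * M)%type) (d, e).
Proof.
move=> /generated_sum_atoms[s [sA ->]] /generated_sum_atoms[t [tA ->]].
have [G0 GD] := generated_submonoidP (M * M)%type.
have -> : (\sum_(a <- s) a, \sum_(a <- t) a) =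
    \sum_(a <- s) ((a, 0) : M * M) + \sum_(a <- t) ((0, a) : M * M).
  rewrite [LHS]surjective_pairing [RHS]surjective_pairing; congr pair => /=.
    by rewrite !raddf_sum /= big1_eq addr0.
  by rewrite !raddf_sum /= big1_eq add0r.
apply: GD; apply: sum_atoms_generated => a.
  by move=> /sA /atom_pairl.
by move=> /tA /atom_pairr.
Qed.

Lemma square_strongly_atomic :
  strongly_atomic M -> strongly_atomic (M * M)%type.
Proof.
move=> /strongly_atomicP MS; apply/strongly_atomicP => -[b1 b2] [c1 c2].
have [d1 [b1' [c1' [d1A -> -> bc1]]]] := MS b1 c1.
have [d2 [b2' [c2' [d2A -> -> bc2]]]] := MS b2 c2.
exists (d1, d2), (b1', b2'), (c1', c2'); split=> //.
  exact: generated_pair.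
move=> [e1 e2] /common_divisor2[[[x1 x2] [? ?]] [[y1 y2] [? ?]]].
apply/square_invertible; split.
  by apply: bc1; apply/common_divisor2; split; [exists x1 | exists y1].
by apply: bc2; apply/common_divisor2; split; [exists x2 | exists y2].
Qed.

(** The pair (x, 0), (0, x) has only unit common divisors, so removing one
    leaves an element associated to (x, 0) or to (0, x). *)
Lemma square_weak_ACCP : weak_ACCP (M * M)%type -> ACCP M.
Proof.
move=> [_ MW]; suff MA (x : M) : element_ACCP x.
  move=> I IP; have [x I0] := IP.1 0%N.
  exact: MA IP I0.
have [||[d1 d2] [/common_divisor2[[[x1 x2] xE] [[y1 y2] yE]]]
    [s [s' [sS sE]]]] :=
  MW [set (x, 0); (0, x)]; [exact: finite_set2 | by exists (x, 0); left |].
have dI : invertible ((d1, d2) : M * M).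
  apply/square_invertible; split; first by exists y1; case: yE.
  by exists x2; case: xE.
have s's : divides s' s by exists (d1, d2); rewrite sE; exact: addrC.
have ss' : divides s s'.
  have [u du] := dI; exists u.
  by rewrite /is_difference sE addrAC du add0r.
have embl y z : divides ((y, 0) : M * M) (z, 0) <-> divides y z.
  split=> [[[w w'] [-> _]] | [w ->]]; first by exists w.
  by exists (w, 0); congr pair; rewrite /= addr0.
have embr y z : divides ((0, y) : M * M) (0, z) <-> divides y z.
  split=> [[[w' w] [_ ->]] | [w ->]]; first by exists w.
  by exists (0, w); congr pair; rewrite /= addr0.
by case: sS s's ss' => ->; [apply: embedding_element_ACCP embl |
                            apply: embedding_element_ACCP embr].
Qed.

End Square.

(** * Adjoining halves *)

Section Halving.
Local Open Scope fset_scope.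
Local Open Scope ring_scope.
Variable D : nmodType.
Implicit Types (d e : D).

(** The pair (d, A) stands for d plus the halves of the elements of A; that A
    is a set, not a multiset, is what makes this normal form unique. *)
Definition halving : Type := (D * {fset {r : D | r != 0}})%type.
Implicit Types (x y z : halving) (A B C U : {fset {r : D | r != 0}}).

HB.instance Definition _ :=
  Choice.copy halving (D * {fset {r : D | r != 0}})%type.

Definition symdiff A B := (A `\` B) `|` (B `\` A).

Lemma in_symdiff A B i : (i \in symdiff A B) = (i \in A) (+) (i \in B).
Proof. by rewrite !inE; do 2?case: (_ \in _). Qed.

Definition total A : D := \sum_(i <- A) val i.

(** When two normal forms are added, the halves that occur in both of them
    merge in pairs and contribute their [total] to the D-component. *)
Definition halving_add x y : halving :=
  (x.1 + y.1 + total (x.2 `&` y.2), symdiff x.2 y.2).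

Lemma total_widen U A : A `<=` U ->
  total A = \sum_(i <- U) val i *+ (i \in A).
Proof.
move=> AU; rewrite -(big_fset_incl _ AU) => [|i _ /negbTE-> //].
by apply: eq_fbigr => i ->.
Qed.

Lemma total0 : total fset0 = 0.
Proof. by rewrite /total big_seq_fset0. Qed.

Lemma halving_addC : commutative halving_add.
Proof.
move=> [d A] [e B]; congr pair; last by rewrite /= /symdiff fsetUC.
by rewrite /= fsetIC [d + e]addrC.
Qed.

(** Both sides add, for each i, the element i as many times as two halves of i
    can be paired among A, B and C. *)
Lemma halving_addA : associative halving_add.
Proof.
move=> [d A] [e B] [f C]; congr pair; last first.
  by apply/fsetP => i; rewrite !in_symdiff addbA.
rewrite /= !addrA [d + e + total _ + f]addrAC -!addrA; do 3!congr (_ + _).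
pose U := A `|` B `|` C.
have AU : A `<=` U by apply/fsubsetP => i; rewrite !inE => ->.
have BU : B `<=` U by apply/fsubsetP => i; rewrite !inE => ->; rewrite orbT.
have CU : C `<=` U by apply/fsubsetP => i; rewrite !inE => ->; rewrite !orbT.
have ABU : symdiff A B `<=` U.
  by apply/fsubsetP => i; rewrite in_symdiff !inE; do 2?case: (_ \in _).
have IU X Y : X `<=` U -> X `&` Y `<=` U.
  by apply: fsubset_trans; exact: fsubsetIl.
rewrite !(total_widen (U := U)) ?IU //.
rewrite -!big_split /=; apply: eq_bigr => i _.
rewrite -!mulrnDr !in_fsetI !in_symdiff.
by congr (_ *+ _); do 3!case: (i \in _).
Qed.

Lemma halving_add0 : left_id ((0, fset0) : halving) halving_add.
Proof.
move=> [d A]; congr pair; first by rewrite /= fset0I total0 add0r addr0.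
by apply/fsetP => i; rewrite in_symdiff inE.
Qed.

HB.instance Definition _ :=
  GRing.isNmodule.Build halving halving_addA halving_addC halving_add0.

Implicit Types r : {r : D | r != 0}.
Definition base d : halving := (d, fset0).
Definition half r : halving := (0, [fset r]).

Lemma base_add d e A : base d + (e, A) = (d + e, A) :> halving.
Proof.
congr pair; first by rewrite /= fset0I total0 addr0.
by apply/fsetP => i; rewrite in_symdiff inE.
Qed.

Lemma half_double r : half r + half r = base (val r).
Proof.
congr pair; first by rewrite /= fsetIid /total big_seq_fset1 !add0r.
by apply/fsetP => i; rewrite in_symdiff addbb.
Qed.

Lemma half_add r d A : r \notin A -> half r + (d, A) = (d, r |` A).
Proof.
move=> rA; have rAI : [fset r] `&` A = fset0.
  apply/fsetP => i; rewrite !inE; case: eqP => [->|] //=.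
  exact: negbTE.
congr pair; first by rewrite /= rAI total0 add0r addr0.
by apply/fsetP => i; rewrite in_symdiff !inE; case: eqP => [->|].
Qed.

Lemma halves_sum A : (0, A) = \sum_(r <- A) half r.
Proof.
elim/fset1U_rect: A => [|r A rA IHA]; first by rewrite big_seq_fset0.
by rewrite big_fsetU1 //= -IHA half_add.
Qed.

Lemma half_divides r x : r \in x.2 -> divides (half r) x.
Proof.
case: x => d A /= rA; exists (d, A `\ r).
by rewrite /is_difference half_add ?fsetD1K // !inE eqxx.
Qed.

Lemma divides_base d e : divides (base d) (base e) <-> divides d e.
Proof.
split=> [[[f F]] | [f ->]]; last first.
  by exists (base f); rewrite /is_difference base_add.
by rewrite /is_difference base_add => -[-> _]; exists f.
Qed.

Hypothesis DC : cancellative D.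
Hypothesis D_reduced : forall u : D, invertible u -> u = 0.

Lemma halving_cancellative : cancellative halving.
Proof.
move=> [d A] [e B] [f C] E.
have /fsetP BC : symdiff A B = symdiff A C := congr1 snd E.
have {}BC : B = C.
  by apply/fsetP => i; have := BC i; rewrite !in_symdiff => /addbI.
have := congr1 fst E; rewrite /= BC -!addrA => /DC.
by rewrite ![_ + total _]addrC => /DC->.
Qed.

Lemma total_eq0 A : total A = 0 -> A = fset0.
Proof.
have [//|[r rA]] := fset_0Vmem A; rewrite /total (big_fsetD1 r) //= => rE.
by have /eqP := valP r; case; apply: D_reduced; exists (total (A `\ r)).
Qed.

Lemma addr_reduced (d e : D) : d + e = 0 -> d = 0 /\ e = 0.
Proof.
by move=> de; split; apply: D_reduced; [exists e | exists d; rewrite addrC].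
Qed.

(** No two halves merge in a decomposition of a sum of distinct halves, since
    merging would leave a nonzero D-component. *)
Lemma halves_split A x y : (0, A) = x + y ->
  [/\ x.1 = 0, y.1 = 0, x.2 `&` y.2 = fset0 & A = x.2 `|` y.2].
Proof.
case: x y => [d B] [e C] E.
have AE : A = symdiff B C := congr1 snd E.
have /esym/addr_reduced[/addr_reduced[-> ->] /total_eq0 BC] :
  0 = d + e + total (B `&` C) := congr1 fst E.
split=> //; rewrite AE; apply/fsetP => i.
have /fsetP/(_ i) := BC; rewrite in_symdiff !inE.
by do 2?case: (_ \in _).
Qed.

Lemma halving_reduced x : invertible x -> x = 0.
Proof.
move=> [y /esym/halves_split[]]; case: x => d A /= -> _ _ /esym/eqP.
by rewrite fsetU_eq0 => /andP[/eqP->].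
Qed.

Lemma atom_half r : atom (half r).
Proof.
split=> [/halving_reduced/(congr1 snd)/fsetP/(_ r) | [d A] [e B]].
  by rewrite !inE eqxx.
move=> /halves_split[/= -> -> AB AUB].
have /orP[rA|rB] : (r \in A) || (r \in B) by rewrite -in_fsetU -AUB inE.
  right; suff -> : B = fset0 by exact: invertible0.
  apply/fsetP => i; rewrite inE; apply/negP => iB.
  have /fset1P ir : i \in [fset r] by rewrite AUB inE iB orbT.
  by have /fsetP/(_ r) := AB; rewrite !inE rA -ir iB.
left; suff -> : A = fset0 by exact: invertible0.
apply/fsetP => i; rewrite inE; apply/negP => iA.
have /fset1P ir : i \in [fset r] by rewrite AUB inE iA.
by have /fsetP/(_ r) := AB; rewrite !inE rB -ir iA.
Qed.

(** Every nonzero element of D is twice its half. *)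
Lemma halving_atomic : atomic halving.
Proof.
move=> [d A] _.
have -> : ((d, A) : halving) = base d + \sum_(r <- A) half r.
  by rewrite -halves_sum base_add addr0.
have halfA (s : seq {r : D | r != 0}) a : a \in [seq half r | r <- s] -> atom a.
  by move=> /mapP[r _ ->]; exact: atom_half.
have [->|d0] := eqVneq d 0.
  exists [seq half r | r <- A]; rewrite big_map add0r; split=> //.
  exact: halfA.
pose r : {r : D | r != 0} := exist _ d d0.
exists [seq half r | r <- r :: r :: A]; split; first exact: halfA.
by rewrite big_map !big_cons addrA half_double.
Qed.

(** The divisors of a sum of distinct halves are its subsums, and the number of
    halves is a rank that drops with each proper divisor. *)
Lemma halves_element_ACCP A : element_ACCP ((0, A) : halving).
Proof.
apply: (@rank_element_ACCP halving _ (fun x => #|` x.2|)) => x z [w AE].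
have [xz0 _ _ _] := halves_split AE.
have : (0, (x + z).2) = x + z by case: (x + z) xz0 => d B /= ->.
move=> /halves_split[_ z0 dis ->].
split; first exact/fsubset_leq_card/fsubsetUl.
move=> card_eq; suff -> : z = 0 by exact: invertible0.
have /fsetP xz : x.2 =i x.2 `|` z.2 by exact/(fsubset_cardP card_eq)/fsubsetUl.
rewrite [LHS]surjective_pairing z0; congr pair; apply/eqP.
by rewrite -fsubset0 -dis fsubsetI fsubset_refl andbT xz fsubsetUr.
Qed.

(** When divisibility is total in D, one D-component of a finite set divides all
    the others; it is a common divisor of the set, and removing it from its own
    element leaves a sum of distinct halves. *)
Lemma halving_weak_ACCP :
  (forall d e : D, divides d e \/ divides e d) -> weak_ACCP halving.
Proof.
move=> Dtotal; split=> [|S /finite_seqP[s ->] Sn]; first exact: halving_atomic.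
suff [x xs xmin] : exists2 x : halving, x \in s &
    forall y, y \in s -> divides x.1 y.1.
  exists (base x.1); split=> [y /xmin[f yE] |].
    exists (f, y.2); rewrite /is_difference base_add -yE.
    exact: surjective_pairing.
  exists x, (0, x.2); split=> //; last exact: halves_element_ACCP.
  by rewrite /is_difference base_add addr0; exact: surjective_pairing.
elim: s Sn => [|x s IHs] Sn; first by case: Sn.
case: s IHs {Sn} => [|y s] IHs.
  exists x; first exact: mem_head.
  by move=> y /[1!inE] /eqP->; exact: divides_refl.
have [|z zs zmin] := IHs; first by exists y; exact: mem_head.
have [xz|zx] := Dtotal x.1 z.1.
  exists x => [|w /[1!inE] /predU1P[-> | /zmin]]; first exact: mem_head.
    exact: divides_refl.
  exact: divides_trans.
by exists z => [|w /[1!inE] /predU1P[->|/zmin]] //; rewrite inE zs orbT.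
Qed.

(** A common divisor of b and c in the halving either leaves a half in both
    cofactors, or leaves the cofactors of a common divisor in D. *)
Lemma halving_not_strongly_atomic (b c : D) :
  (forall d b' c', b = d + b' -> c = d + c' ->
     exists e, [/\ e <> 0, divides e b' & divides e c']) ->
  ~ strongly_atomic halving.
Proof.
move=> bcN /strongly_atomicP/(_ (base b) (base c)).
move=> [[d A] [[b' B] [[c' C] [_ bE cE bc]]]].
have AXE X : fset0 = symdiff A X -> X = A.
  move=> /fsetP AX; apply/fsetP => i; have := AX i.
  by rewrite in_symdiff inE; do 2?case: (_ \in _).
have BA : B = A := AXE _ (congr1 snd bE).
have CA : C = A := AXE _ (congr1 snd cE).
rewrite {}BA {}CA in bE cE bc.
have {}bE : b = d + b' + total (A `&` A) := congr1 fst bE.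
have {}cE : c = d + c' + total (A `&` A) := congr1 fst cE.
have [A0|[r rA]] := fset_0Vmem A; last first.
  have [] := atom_half r; case; apply: bc.
  by apply/common_divisor2; split; exact: half_divides.
rewrite A0 fset0I total0 addr0 in bE; rewrite A0 fset0I total0 addr0 in cE.
have [e [e0 eb ec]] := bcN _ _ _ bE cE.
apply: e0; suff /halving_reduced[] : invertible (base e) by [].
by apply/bc/common_divisor2; rewrite A0; split; apply/divides_base.
Qed.

End Halving.

(** * Submonoids of abelian groups *)

Section Submonoid.
Variables (V : zmodType) (S : {pred V}) (S_closed : GRing.nmod_closed S).

(** The closure proof is a parameter of the type so that instance resolution
    can find it. *)
Definition submonoid_of (_ : GRing.nmod_closed S) : Type := {x : V | x \in S}.
Local Notation T := (submonoid_of S_closed).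

HB.instance Definition _ := [isSub for (@sval V _ : T -> V)].
HB.instance Definition _ := [Choice of T by <:].
HB.instance Definition _ :=
  GRing.SubChoice_isSubNmodule.Build V _ T S_closed.

Definition in_submonoid (x : V) (xS : x \in S) : T :=
  exist (fun v => v \in S) x xS.

Lemma submonoid_of_cancellative : cancellative T.
Proof.
by move=> x y z /(congr1 val); rewrite !raddfD => /addrI/val_inj.
Qed.

Lemma submonoid_of_dividesP (x y : T) :
  divides x y <-> val y - val x \in S.
Proof.
split=> [[z ->] | yxS]; first by rewrite raddfD /= addrC addKr; exact: valP.
exists (in_submonoid yxS); apply: val_inj; rewrite raddfD /=.
by rewrite addrC subrK.
Qed.

Lemma submonoid_of_reduced :
  (forall x : V, x \in S -> - x \in S -> x = 0) ->
  forall u : T, invertible u -> u = 0.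
Proof.
move=> S0 u [v /(congr1 val)]; rewrite raddfD => /eqP.
rewrite addr_eq0 => /eqP uv.
apply: val_inj; apply: S0; first exact: valP.
by rewrite uv opprK; exact: valP.
Qed.

End Submonoid.

(** * Nonnegative rationals *)

Lemma nneg_closed : GRing.nmod_closed [pred q : rat | 0 <= q].
Proof. by split=> // p q; rewrite !inE; exact: addr_ge0. Qed.

Definition nnrat := submonoid_of nneg_closed.

Lemma nnrat_reduced (u : nnrat) : invertible u -> u = 0.
Proof.
apply: submonoid_of_reduced => x; rewrite !inE oppr_ge0 => x0 x0'.
by apply/eqP; rewrite eq_le x0 x0'.
Qed.

Lemma nnrat_divides (x y : nnrat) : divides x y <-> val x <= val y.
Proof. by rewrite -subr_ge0; exact: submonoid_of_dividesP. Qed.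

Lemma nnrat_not_ACCP : ~ ACCP nnrat.
Proof.
have inv_ge0 n : (n.+1%:R^-1 : rat) \in [pred q : rat | 0 <= q].
  by rewrite inE /= invr_ge0.
pose x n : nnrat := in_submonoid nneg_closed (inv_ge0 n).
move=> /(_ (fun n => principal_ideal (x n)))[|N NP].
  apply: principal_chain => n; apply/nnrat_divides.
  by rewrite /= lef_pV2 ?posrE // ler_nat.
have /principal_ideal_subset/nnrat_divides/= :
  (principal_ideal (x N.+1) `<=` principal_ideal (x N))%classic by rewrite NP.
by rewrite lef_pV2 ?posrE // ler_nat ltnn.
Qed.

(** * A monoid without maximal common divisors *)

Definition open_halfplane0 : {pred rat * int} :=
  [pred p | (0 < p.1) || (p == 0)].

Lemma open_halfplane0_closed : GRing.nmod_closed open_halfplane0.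
Proof.
split=> [|p q]; first by rewrite !inE eqxx orbT.
rewrite !inE => /orP[p0|/eqP->]; last by rewrite add0r.
by move=> /orP[q0|/eqP->]; [rewrite addr_gt0 | rewrite addr0 p0].
Qed.

Definition halfplane_monoid := submonoid_of open_halfplane0_closed.

Lemma halfplane_reduced (u : halfplane_monoid) : invertible u -> u = 0.
Proof.
apply: submonoid_of_reduced => x; rewrite !inE oppr_eq0.
case: eqP => // _; rewrite !orbF /= => x0.
by rewrite oppr_gt0 ltNge ltW.
Qed.

Lemma unit_height_in (z : int) : (1, z) \in open_halfplane0.
Proof. by rewrite inE. Qed.

Definition unit_height (z : int) : halfplane_monoid :=
  in_submonoid open_halfplane0_closed (unit_height_in z).

(** A common divisor differs from both elements, since neither divides the
    other; both cofactors then have positive height. *)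
Lemma halfplane_no_mcd (d b c : halfplane_monoid) :
  unit_height 0 = d + b -> unit_height 1 = d + c ->
  exists e, [/\ e <> 0, divides e b & divides e c].
Proof.
move=> bE cE.
have {}bE : val b = (1, 0) - val d.
  by apply/eqP; rewrite eq_sym subr_eq addrC -raddfD -bE.
have {}cE : val c = (1, 1) - val d.
  by apply/eqP; rewrite eq_sym subr_eq addrC -raddfD -cE.
have := valP b; have := valP c; rewrite bE cE !inE /= => c0 b0.
have h0 : 0 < 1 - (val d).1.
  case/orP: b0 => //; rewrite subr_eq0 => /eqP dE.
  by move: c0; rewrite -dE.
(* Half of the height that is left is below both cofactors. *)
have eP : ((1 - (val d).1) / 2, 0) \in open_halfplane0.
  by rewrite inE /= divr_gt0.
exists (in_submonoid open_halfplane0_closed eP); split.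
- move=> /(congr1 val)/(congr1 fst) /= /eqP.
  by rewrite mulf_eq0 invr_eq0 (gt_eqF h0).
- by apply/submonoid_of_dividesP; rewrite bE inE /=; apply/orP; left; lra.
- by apply/submonoid_of_dividesP; rewrite cE inE /=; apply/orP; left; lra.
Qed.

Theorem proposition3p10 :
  (forall M : nmodType, cancellative M -> strongly_atomic M -> atomic M) /\
  (forall M : nmodType, cancellative M -> weak_ACCP M -> strongly_atomic M) /\
  ((exists M : nmodType, cancellative M /\ weak_ACCP M /\ ~ ACCP M) /\
   (exists M : nmodType,
      cancellative M /\ strongly_atomic M /\ ~ weak_ACCP M) /\
   (exists M : nmodType, cancellative M /\ atomic M /\ ~ strongly_atomic M)).
Proof.
split; first exact: strongly_atomic_atomic.
split; first exact: weak_ACCP_strongly_atomic.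
have QC : cancellative (halving nnrat).
  exact/halving_cancellative/submonoid_of_cancellative.
have QW : weak_ACCP (halving nnrat).
  apply: halving_weak_ACCP; first exact: nnrat_reduced.
  move=> x y; case: (leP (val x) (val y)) => [xy|/ltW yx].
    by left; apply/nnrat_divides.
  by right; apply/nnrat_divides.
have QN : ~ ACCP (halving nnrat).
  by move=> /(embedding_ACCP (@divides_base nnrat)); exact: nnrat_not_ACCP.
split; first by exists (halving nnrat).
split.
  exists (halving nnrat * halving nnrat)%type; split.
    exact: square_cancellative.
  split; last by move=> /square_weak_ACCP.
  exact/square_strongly_atomic/weak_ACCP_strongly_atomic.
exists (halving halfplane_monoid); split.
  exact/halving_cancellative/submonoid_of_cancellative.
split; first exact/halving_atomic/halfplane_reduced.
apply: (halving_not_strongly_atomic halfplane_reduced (b := unit_height 0)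
  (c := unit_height 1)).
exact: halfplane_no_mcd.
Qed.
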